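(* Let $\epsilon\ge 0$ and $\beta$ be reals, and let $A,B\subseteq\{0,1\}^n$ form a Uniquely Decodable Code Pair with $|A|\ge 2^{(1-\epsilon)n}$ and $|B|\ge 2^{\beta n}$. Then $\beta\le 0.4777+\epsilon+0.7676\sqrt{\epsilon(1-\beta)}$.
   Context: Two sets $A,B\subseteq\{0,1\}^n$ form a Uniquely Decodable Code Pair (UDCP) if every pair $(a,b)\in A\times B$ yields a distinct sum $a+b$, where addition is over $\mathbb{Z}^n$; equivalently $|A+B|=|A|\cdot|B|$. *)

(* Defs.v *)
From Stdlib Require Import Reals.
From mathcomp Require Import all_boot.
Set Implicit Arguments. Unset Strict Implicit. Unset Printing Implicit Defensive.

Definition word (n : nat) := {ffun 'I_n -> bool}.

(* Coordinatewise sum over Z^n (entries lie in {0,1,2}, so nat suffices). *)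
Definition wsum (n : nat) (a b : word n) : 'I_n -> nat :=
  fun i => (nat_of_bool (a i) + nat_of_bool (b i))%N.

Definition UDCP (n : nat) (A B : {set word n}) : Prop :=
  forall a1 a2 b1 b2, a1 \in A -> a2 \in A -> b1 \in B -> b2 \in B ->
    wsum a1 b1 =1 wsum a2 b2 -> a1 = a2 /\ b1 = b2.

(* Main.v *)
Require Import Defs.
From HB Require Import structures.
From Stdlib Require Import Reals Lra.
From Coquelicot Require Import Coquelicot.
From mathcomp Require Import all_boot.
Local Open Scope R_scope.

(* For [0 < rho < 1] let [(a, b)] be a uniform pair of [rho]-correlated words. Writing
   [Pr] for the probability that [a] lies in [A] and [b] in [B], two bounds are compared.
   Lower bound: reverse hypercontractivity gives [Pr >= mu(A)^r mu(B)^r'], where [mu] is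
   density and [(1 - 1/r)(1 - 1/r') = rho^2].
   Upper bound: the probability of [(a, b)] depends only on [a - b], which determines the
   pair in a UDCP, so [Pr] is at most the sum over all of [{-1,0,1}^n], which equals
   [((3 - rho)/4)^n].
   With [r = (1 + rho s)/(1 - rho^2)] and [r' = (1 + rho/s)/(1 - rho^2)] this reads
   [(1 - rho^2) log2 (4/(3 - rho)) <= eps (1 + rho s) + (1 - beta) (1 + rho/s)];
   take [s = sqrt ((1 - beta)/eps)] and [rho = 0.3838], which nearly maximizes the left
   side. *)

(** * A power inequality for cosh *)

Lemma cosh_gt0 x : 0 < cosh x.
Proof. rewrite /cosh; have := exp_pos x; have := exp_pos (- x); lra. Qed.

Lemma sinh_ge0 x : 0 <= x -> 0 <= sinh x.
Proof.
move=> x0; rewrite /sinh.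
have : exp (- x) <= exp x by case: (Req_dec x 0) => [->|?]; [rewrite Ropp_0; lra|left; apply: exp_increasing; lra].
lra.
Qed.

Lemma sinhB x y : sinh (x - y) = sinh x * cosh y - cosh x * sinh y.
Proof.
rewrite /sinh /cosh Ropp_minus_distr /Rminus !exp_plus; field.
Qed.

Lemma coshB x y : cosh (x - y) = cosh x * cosh y - sinh x * sinh y.
Proof.
rewrite /sinh /cosh Ropp_minus_distr /Rminus !exp_plus; field.
Qed.

Lemma cosh2_sinh2 x : cosh x * cosh x - sinh x * sinh x = 1.
Proof. by rewrite -coshB Rminus_diag cosh_0. Qed.

Lemma is_derive_cosh c x : is_derive (fun y => cosh (c * y)) x (c * sinh (c * x)).
Proof. rewrite /cosh /sinh; auto_derive => //; field. Qed.

Lemma is_derive_sinh c x : is_derive (fun y => sinh (c * y)) x (c * cosh (c * x)).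
Proof. rewrite /cosh /sinh; auto_derive => //; field. Qed.

Lemma is_derive_ln_cosh c x :
  is_derive (fun y => ln (cosh (c * y))) x (c * sinh (c * x) / cosh (c * x)).
Proof.
have E : c * sinh (c * x) / cosh (c * x) =
  scal (c * sinh (c * x)) (/ cosh (c * x)) by [].
rewrite E; apply: (is_derive_comp ln (fun y => cosh (c * y))).
  exact: is_derive_ln (cosh_gt0 _).
exact: is_derive_cosh.
Qed.

Lemma le_of_derive_ge0 (f f' : R -> R) h :
  (forall x, is_derive f x (f' x)) -> (forall x, 0 <= x -> 0 <= f' x) ->
  0 <= h -> f 0 <= f h.
Proof.
move=> fd f0 h0.
have [||c [[c0 _] E]] := MVT_gen f 0 h f'.
- by move=> x _; apply: fd.
- move=> x _; apply/continuity_pt_filterlim.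
  by apply: (ex_derive_continuous f); exists (f' x); apply: fd.
- have {}c0 : 0 <= c by move: c0; rewrite Rmin_left.
  have := Rmult_le_pos _ _ (f0 _ c0) h0; lra.
Qed.

(** Both sides agree at 0, and the derivative of the difference is [t] times [tanh (t x) - tanh x],
    which has the sign of [sinh (t x - x)]. *)
Lemma cosh_pow_le t h : 1 <= t -> 0 <= h -> t * ln (cosh h) <= ln (cosh (t * h)).
Proof.
move=> t1 h0.
pose f x := ln (cosh (t * x)) - t * ln (cosh (1 * x)).
pose f' x := t * sinh (t * x) / cosh (t * x) - t * (1 * sinh (1 * x) / cosh (1 * x)).
have := le_of_derive_ge0 f f' h _ _ h0; rewrite /f !Rmult_0_r Rmult_1_l cosh_0 ln_1.
suff: (forall x, is_derive f x (f' x)) /\ (forall x, 0 <= x -> 0 <= f' x).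
  by case=> H1 H2 /(_ H1 H2); lra.
split=> x.
  apply: (is_derive_minus (fun x => ln (cosh (t * x)))).
    exact: is_derive_ln_cosh.
  by apply: (is_derive_scal (fun x => ln (cosh (1 * x)))); apply: is_derive_ln_cosh.
move=> x0; rewrite /f' !Rmult_1_l.
have c1 := cosh_gt0 (t * x); have c2 := cosh_gt0 x.
have -> : t * sinh (t * x) / cosh (t * x) - t * (sinh x / cosh x) =
  t * sinh (t * x - x) / (cosh (t * x) * cosh x) by rewrite sinhB; field; lra.
apply: Rmult_le_pos; last by left; apply: Rinv_0_lt_compat; apply: Rmult_lt_0_compat.
apply: Rmult_le_pos; first lra; apply: sinh_ge0; nra.
Qed.

Lemma is_derive_cosh_pow s x :
  is_derive (fun y => exp (s * ln (cosh (1 * y)))) x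
    (s * (sinh x / cosh x) * exp (s * ln (cosh x))).
Proof.
have E : s * (sinh x / cosh x) * exp (s * ln (cosh x)) =
  scal (s * (1 * sinh (1 * x) / cosh (1 * x))) (exp (s * ln (cosh (1 * x)))).
  by rewrite !Rmult_1_l.
rewrite E; apply: (is_derive_comp exp (fun y => s * ln (cosh (1 * y)))).
  exact: is_derive_exp.
by apply: (is_derive_scal (fun x => ln (cosh (1 * x)))); apply: is_derive_ln_cosh.
Qed.

(** The derivative form of [cosh_Rpower_le]. After division by [cosh ^ s], differentiating once more
    leaves [cosh x ^ (s - 1) <= cosh ((s - 1) x)], which is [cosh_pow_le] at exponent [s - 1]; hence
    [2 <= s]. *)
Lemma tanh_cosh_pow_le s h : 2 <= s -> 0 <= h ->
  s * (sinh h / cosh h) * exp (s * ln (cosh h)) <= sinh (s * h).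
Proof.
move=> s2 h0.
pose f x := sinh (s * x) * exp (- s * ln (cosh (1 * x)))
            - s * (sinh (1 * x) / cosh (1 * x)).
pose f' x := (s * cosh (s * x) * exp (- s * ln (cosh (1 * x)))
    + sinh (s * x) * (- s * (sinh x / cosh x) * exp (- s * ln (cosh x))))
  - s * ((1 * cosh (1 * x) * cosh (1 * x) - sinh (1 * x) * (1 * sinh (1 * x)))
     / cosh (1 * x) ^ 2).
suff: (forall x, is_derive f x (f' x)) /\ (forall x, 0 <= x -> 0 <= f' x).
  case=> H1 H2; have := le_of_derive_ge0 f f' h H1 H2 h0.
  rewrite /f !Rmult_0_r sinh_0 Rmult_0_l /Rdiv Rmult_0_l Rmult_0_r !Rmult_1_l.
  move=> H; apply: (Rmult_le_reg_r (exp (- s * ln (cosh h)))); first exact: exp_pos.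
  rewrite Rmult_assoc -exp_plus.
  have -> : s * ln (cosh h) + - s * ln (cosh h) = 0 by ring.
  rewrite exp_0; lra.
split=> x.
  apply: (is_derive_minus (fun x => sinh (s * x) * exp (- s * ln (cosh (1 * x))))).
    apply: (is_derive_mult (fun x => sinh (s * x))).
    - exact: is_derive_sinh.
    - exact: is_derive_cosh_pow.
    - by move=> ? ?; apply: Rmult_comm.
  apply: (is_derive_scal (fun x => sinh (1 * x) / cosh (1 * x))).
  apply: (is_derive_div (fun x => sinh (1 * x))).
  - exact: is_derive_sinh.
  - exact: is_derive_cosh.
  - have := cosh_gt0 (1 * x); lra.
move=> x0; rewrite /f' !Rmult_1_l cosh2_sinh2.
have c2 := cosh_gt0 x.
set E := exp _.
have -> : s * cosh (s * x) * E + sinh (s * x) * (- s * (sinh x / cosh x) * E)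
   - s * (1 / cosh x ^ 2) =
   s / cosh x * (E * cosh (s * x - x) - 1 / cosh x) by rewrite coshB; field; lra.
apply: Rmult_le_pos.
  apply: Rmult_le_pos; first lra.
  by left; apply: Rinv_0_lt_compat.
have <- : E * exp ((s - 1) * ln (cosh x)) = 1 / cosh x.
  rewrite /E -exp_plus.
  have -> : - s * ln (cosh x) + (s - 1) * ln (cosh x) = - ln (cosh x) by ring.
  by rewrite exp_Ropp exp_ln // /Rdiv Rmult_1_l.
have : exp ((s - 1) * ln (cosh x)) <= cosh (s * x - x).
  have -> : s * x - x = (s - 1) * x by ring.
  rewrite -[X in _ <= X]exp_ln; last exact: cosh_gt0.
  have : (s - 1) * ln (cosh x) <= ln (cosh ((s - 1) * x)) by apply: cosh_pow_le; lra.
  case=> [/exp_increasing|->]; lra.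
have := exp_pos (- s * ln (cosh x)); rewrite -/E; nra.
Qed.

(** Equality holds at [h = 0], and [tanh_cosh_pow_le] compares the derivatives. *)
Lemma cosh_Rpower_le s h : 2 <= s -> 0 <= h ->
  s * Rpower (cosh h) s <= cosh (s * h) + (s - 1).
Proof.
move=> s2 h0.
pose f x := cosh (s * x) - s * exp (s * ln (cosh (1 * x))).
pose f' x := s * sinh (s * x) - s * (s * (sinh x / cosh x) * exp (s * ln (cosh x))).
suff: (forall x, is_derive f x (f' x)) /\ (forall x, 0 <= x -> 0 <= f' x).
  case=> H1 H2; have := le_of_derive_ge0 f f' h H1 H2 h0.
  rewrite /f /Rpower !Rmult_0_r Rmult_1_l cosh_0 ln_1 Rmult_0_r exp_0; lra.
split=> x.
  apply: (is_derive_minus (fun x => cosh (s * x))).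
    exact: is_derive_cosh.
  apply: (is_derive_scal (fun x => exp (s * ln (cosh (1 * x))))).
  exact: is_derive_cosh_pow.
move=> x0; rewrite /f'.
have := tanh_cosh_pow_le s x s2 x0; nra.
Qed.

(** * The two-point inequality *)

(* Unlike [Rpower], which satisfies [Rpower 0 r = 1], this power vanishes at 0. *)
Definition pw (x r : R) : R := if Rlt_dec 0 x then Rpower x r else 0.

Lemma pw_pos x r : 0 < x -> pw x r = Rpower x r.
Proof. by rewrite /pw; case: Rlt_dec. Qed.

Lemma pw0 r : pw 0 r = 0.
Proof. by rewrite /pw; case: Rlt_dec => // H; case: (Rlt_irrefl 0). Qed.

Lemma pw_ge0 x r : 0 <= pw x r.
Proof. by rewrite /pw; case: Rlt_dec => ?; [left; apply: exp_pos|right]. Qed.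

(** Equality at [s = 2]; beyond it, [exp x >= 1 + x] and [ln 2 > 1/2] give enough growth. *)
Lemma double_le_Rpower2 s : 2 <= s -> 2 * s <= Rpower 2 s.
Proof.
move=> s2; have -> : s = INR 2 + (s - 2) by rewrite /=; ring.
rewrite Rpower_plus Rpower_pow; last lra.
have l2 := ln_lt_2; have := exp_ineq1_le ((s - 2) * ln 2); rewrite /Rpower /=; nra.
Qed.

(** The case [v = 0] of [pw_mean_sqr_le], out of reach of the exponential substitution there.
    Homogeneity reduces it to [4 r <= 2 ^ (2 r)]. *)
Lemma pw_half_sqr_le r u : 1 <= r -> 0 <= u ->
  4 * r * pw (u / 2) r ^ 2 <= pw u r ^ 2.
Proof.
move=> r1 [u0|<-]; last by rewrite /Rdiv Rmult_0_l pw0; nra.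
rewrite !pw_pos //; last lra.
have E : u = u / 2 * 2 by field.
rewrite [X in _ <= Rpower X _ ^ _]E -Rpower_mult_distr; try lra.
have := double_le_Rpower2 (r + r); rewrite Rpower_plus => H.
have {}H : 4 * r <= Rpower 2 r * Rpower 2 r by lra.
have : 0 <= Rpower (u / 2) r ^ 2 by nra.
nra.
Qed.

(* With [u = exp (c + h)] and [v = exp (c - h)] this is [cosh_Rpower_le] at [s = 2 r]. *)
Lemma pw_mean_sqr_le r u v : 1 <= r -> 0 <= u -> 0 <= v ->
  4 * r * pw ((u + v) / 2) r ^ 2 <=
  pw u r ^ 2 + pw v r ^ 2 + (4 * r - 2) * (pw u r * pw v r).
Proof.
move=> r1; wlog le_vu : u v / v <= u.
  move=> H u0 v0; case: (Rle_lt_dec v u) => [|/Rlt_le] le; first exact: H.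
  have := H v u le v0 u0; rewrite (Rplus_comm v u); lra.
move=> u0' [v0|<-]; last first.
  by rewrite Rplus_0_r pw0; have := pw_half_sqr_le r u r1 u0'; lra.
have u0 : 0 < u by lra.
pose c := (ln u + ln v) / 2; pose h := (ln u - ln v) / 2.
have h0 : 0 <= h.
  rewrite /h; have : ln v <= ln u by case: le_vu => [/(ln_increasing _ _ v0)|->]; lra.
  lra.
have Eu : u = exp (c + h) by rewrite -[LHS]exp_ln //; congr exp; rewrite /c /h; field.
have Ev : v = exp (c - h) by rewrite -[LHS]exp_ln //; congr exp; rewrite /c /h; field.
have Em : (u + v) / 2 = exp c * cosh h.
  by rewrite Eu Ev /cosh /Rminus !exp_plus; field.
rewrite !pw_pos ?Em; try lra.
rewrite Eu Ev /Rpower ln_mult; [|exact: exp_pos|exact: cosh_gt0].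
rewrite !ln_exp.
have := cosh_Rpower_le (2 * r) h ltac:(lra) h0.
rewrite /Rpower /cosh -/(cosh h).
have -> : exp (r * (c + ln (cosh h))) ^ 2 = exp (2 * r * c) * exp (2 * r * ln (cosh h)).
  by rewrite /= Rmult_1_r -!exp_plus; congr exp; ring.
have -> : exp (r * (c + h)) ^ 2 = exp (2 * r * c) * exp (2 * r * h).
  by rewrite /= Rmult_1_r -!exp_plus; congr exp; ring.
have -> : exp (r * (c - h)) ^ 2 = exp (2 * r * c) * exp (- (2 * r * h)).
  by rewrite /= Rmult_1_r -!exp_plus; congr exp; ring.
have -> : exp (r * (c + h)) * exp (r * (c - h)) = exp (2 * r * c).
  by rewrite -!exp_plus; congr exp; ring.
have := exp_pos (2 * r * c); nra.
Qed.

(* By [pw_mean_sqr_le] each factor on the left is at most [sqrt (m^2 - (1 - 1/r) d^2)],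
   for [m], [d] the half sum and half difference of the endpoint values; the product of
   two such roots is at most [m m' + rho d d'] because the difference of the squares is
   a perfect square. *)
Lemma two_point rho r r' u0 u1 v0 v1 : 0 <= rho <= 1 -> 1 <= r -> 1 <= r' ->
  (1 - / r) * (1 - / r') = rho ^ 2 ->
  0 <= u0 -> 0 <= u1 -> 0 <= v0 -> 0 <= v1 ->
  4 * (pw ((u0 + u1) / 2) r * pw ((v0 + v1) / 2) r') <=
  (pw u0 r + pw u1 r) * (pw v0 r' + pw v1 r') +
  rho * ((pw u0 r - pw u1 r) * (pw v0 r' - pw v1 r')).
Proof.
move=> [rho0 rho1] r1 r1' Erho u0p u1p v0p v1p.
have := pw_mean_sqr_le r u0 u1 r1 u0p u1p.
have := pw_mean_sqr_le r' v0 v1 r1' v0p v1p.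
have := pw_ge0 ((u0 + u1) / 2) r; have := pw_ge0 ((v0 + v1) / 2) r'.
have := pw_ge0 u0 r; have := pw_ge0 u1 r.
have := pw_ge0 v0 r'; have := pw_ge0 v1 r'.
move: (pw u0 r) (pw u1 r) (pw v0 r') (pw v1 r') (pw ((u0 + u1) / 2) r) (pw ((v0 + v1) / 2) r').
move=> x0 x1 y0 y1 f g y1p y0p x1p x0p gp fp Hg Hf.
have inv01 z : 1 <= z -> 0 < / z <= 1.
  by move=> z1; split; [apply: Rinv_0_lt_compat; lra|rewrite -Rinv_1; apply: Rinv_le_contravar; lra].
have [i0 i1] := inv01 r r1; have [j0 j1] := inv01 r' r1'.
pose P := 1 - / r; pose Q := 1 - / r'.
have P0 : 0 <= P by rewrite /P; lra.
have Q0 : 0 <= Q by rewrite /Q; lra.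
have {}Hf : 4 * f ^ 2 <= (x0 + x1) ^ 2 - P * (x0 - x1) ^ 2.
  have -> : (x0 + x1) ^ 2 - P * (x0 - x1) ^ 2 =
    / r * (x0 ^ 2 + x1 ^ 2 + (4 * r - 2) * (x0 * x1)) by rewrite /P; field; lra.
  have -> : 4 * f ^ 2 = / r * (4 * r * f ^ 2) by field; lra.
  by apply: Rmult_le_compat_l; lra.
have {}Hg : 4 * g ^ 2 <= (y0 + y1) ^ 2 - Q * (y0 - y1) ^ 2.
  have -> : (y0 + y1) ^ 2 - Q * (y0 - y1) ^ 2 =
    / r' * (y0 ^ 2 + y1 ^ 2 + (4 * r' - 2) * (y0 * y1)) by rewrite /Q; field; lra.
  have -> : 4 * g ^ 2 = / r' * (4 * r' * g ^ 2) by field; lra.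
  by apply: Rmult_le_compat_l; lra.
have E : sqrt P * sqrt Q = rho by rewrite -sqrt_mult // Erho sqrt_pow2.
have EP := sqrt_sqrt P P0; have EQ := sqrt_sqrt Q Q0.
set p := sqrt P in E EP; set q := sqrt Q in E EQ.
set M := x0 + x1 in Hf *; set D := x0 - x1 in Hf *.
set N := y0 + y1 in Hg *; set L := y0 - y1 in Hg *.
(* Squares may be compared because the right side is nonnegative: [|D| <= M], [|L| <= N] and
   [rho <= 1]. *)
apply: Rsqr_incr_0_var; last first.
  have : Rabs D <= M by rewrite /D /M; apply: Rabs_le; lra.
  have : Rabs L <= N by rewrite /L /N; apply: Rabs_le; lra.
  have := Rabs_pos D; have := Rabs_pos L => aL aD lL lD.
  have : Rabs D * Rabs L <= M * N by apply: Rmult_le_compat.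
  rewrite -Rabs_mult => H.
  have := Rle_abs (- (D * L)); have := Rabs_pos (D * L); rewrite Rabs_Ropp.
  move: (D * L) (Rabs (D * L)) (M * N) H => z az mn H a0 az'.
  case: (Rle_lt_dec 0 z) => z0; nra.
have H : (4 * f ^ 2) * (4 * g ^ 2) <= (M ^ 2 - P * D ^ 2) * (N ^ 2 - Q * L ^ 2).
  by apply: Rmult_le_compat => //; nra.
have K : (M * N + rho * (D * L)) ^ 2 - (M ^ 2 - P * D ^ 2) * (N ^ 2 - Q * L ^ 2) =
  (p * D * N + q * L * M) ^ 2 by rewrite -EP -EQ -E; ring.
have := pow2_ge_0 (p * D * N + q * L * M).
rewrite /Rsqr; lra.
Qed.

(** * Correlated pairs of words *)

Lemma RplusA : associative Rplus. Proof. by move=> *; ring. Qed.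
Lemma RmultA : associative Rmult. Proof. by move=> *; ring. Qed.
HB.instance Definition _ := Monoid.isComLaw.Build R 0 Rplus RplusA Rplus_comm Rplus_0_l.
HB.instance Definition _ := Monoid.isComLaw.Build R 1 Rmult RmultA Rmult_comm Rmult_1_l.
HB.instance Definition _ := Monoid.isMulLaw.Build R 0 Rmult Rmult_0_l Rmult_0_r.
HB.instance Definition _ := Monoid.isAddLaw.Build R Rmult Rplus
  (fun x y z => Rmult_plus_distr_r x y z) Rmult_plus_distr_l.

Lemma sumR_ge0 (I : finType) (P : pred I) (F : I -> R) :
  (forall i, 0 <= F i) -> 0 <= \big[Rplus/0]_(i | P i) F i.
Proof.
move=> F0; elim/big_ind: _ => [|x y|i _]; [by right|exact: Rplus_le_le_0_compat|exact: F0].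
Qed.

Lemma sumR_le_all (I : finType) (P : pred I) (F : I -> R) :
  (forall i, 0 <= F i) -> \big[Rplus/0]_(i | P i) F i <= \big[Rplus/0]_i F i.
Proof.
move=> F0; rewrite [X in _ <= X](bigID P) /=.
have := sumR_ge0 I (fun i => ~~ P i) F F0; lra.
Qed.

Definition wcons n (x : bool) (a : word n) : word n.+1 :=
  [ffun i => oapp a x (unlift ord0 i)].

Lemma wcons0 n x (a : word n) : wcons n x a ord0 = x.
Proof. by rewrite ffunE unlift_none. Qed.

Lemma wconsS n x (a : word n) i : wcons n x a (lift ord0 i) = a i.
Proof. by rewrite ffunE liftK. Qed.

Definition slice n (A : {set word n.+1}) (x : bool) : {set word n} :=
  [set a | wcons n x a \in A].

(** A general commutative law lets one splitting serve both cardinalities and real sums. *)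
Lemma big_slice (T : Type) (idx : T) (op : Monoid.com_law idx) n
    (A : {set word n.+1}) (F : word n.+1 -> T) :
  \big[op/idx]_(a in A) F a =
  op (\big[op/idx]_(a in slice n A true) F (wcons n true a))
     (\big[op/idx]_(a in slice n A false) F (wcons n false a)).
Proof.
transitivity (\big[op/idx]_(x : bool) \big[op/idx]_(a | wcons n x a \in A) F (wcons n x a)).
  rewrite pair_big_dep /= (reindex (fun p : bool * word n => wcons n p.1 p.2)) //=.
  exists (fun a : word n.+1 => (a ord0, [ffun i => a (lift ord0 i)])).
    move=> [x a] _ /=; rewrite wcons0; congr (_, _).
    by apply/ffunP=> i; rewrite ffunE wconsS.
  move=> a _ /=; apply/ffunP=> i; case: (unliftP ord0 i) => [j|] ->.
    by rewrite wconsS ffunE.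
  by rewrite wcons0.
by rewrite big_bool; congr (op _ _); apply: eq_bigl => a; rewrite inE.
Qed.

Lemma card_slice n (A : {set word n.+1}) :
  INR #|A| = INR #|slice n A true| + INR #|slice n A false|.
Proof. by rewrite -plus_INR plusE -!sum1_card big_slice. Qed.

(** Divided by [4 ^ n], this is the joint law of two uniform words whose bits have correlation
    [rho], independently across coordinates. *)
Definition noise (rho : R) n (a b : word n) : R :=
  \big[Rmult/1]_(i < n) if a i == b i then 1 + rho else 1 - rho.

Lemma noise_cons rho n x y (a b : word n) :
  noise rho n.+1 (wcons n x a) (wcons n y b) =
  (if x == y then 1 + rho else 1 - rho) * noise rho n a b.
Proof.
rewrite /noise big_ord_recl !wcons0; congr (_ * _).
by apply: eq_bigr => i _; rewrite !wconsS.
Qed.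

(* [4 ^ n] times the probability that a [rho]-correlated pair falls in [A * B]. *)
Definition mass rho n (A B : {set word n}) : R :=
  \big[Rplus/0]_(a in A) \big[Rplus/0]_(b in B) noise rho n a b.

Lemma mass_slice rho n (A B : {set word n.+1}) :
  mass rho n.+1 A B =
  (1 + rho) * (mass rho n (slice n A true) (slice n B true)
               + mass rho n (slice n A false) (slice n B false))
  + (1 - rho) * (mass rho n (slice n A true) (slice n B false)
                 + mass rho n (slice n A false) (slice n B true)).
Proof.
have E x : \big[Rplus/0]_(a in slice n A x)
      \big[Rplus/0]_(b in B) noise rho n.+1 (wcons n x a) b =
   (1 + rho) * mass rho n (slice n A x) (slice n B x)
   + (1 - rho) * mass rho n (slice n A x) (slice n B (~~ x)).
  rewrite /mass !big_distrr /= -big_split /=; apply: eq_bigr => a _.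
  rewrite big_slice !big_distrr /=.
  case: x => /=; [|rewrite [LHS]Rplus_comm]; congr (_ + _);
    by apply: eq_bigr => b _; rewrite noise_cons.
by rewrite {1}/mass big_slice /= !E /=; ring.
Qed.

(** Induction on [n], slicing by the first bit: the density of a set is the mean of its slice
    densities, and the four slice masses, bounded by induction, recombine into the right side of
    [two_point]. *)
Lemma reverse_hypercontractive rho r r' n (A B : {set word n}) :
  0 <= rho <= 1 -> 1 <= r -> 1 <= r' -> (1 - / r) * (1 - / r') = rho ^ 2 ->
  4 ^ n * (pw (INR #|A| / 2 ^ n) r * pw (INR #|B| / 2 ^ n) r') <= mass rho n A B.
Proof.
move=> rho01 r1 r1' E; elim: n A B => [|n IH] A B.
  (* There is a single word of length 0. An empty set makes the left side vanish because [pw 0 r] is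
     0. *)
  have c1 (C : {set word 0}) : C = set0 \/ C = setT.
    have W (a b : word 0) : a = b by apply/ffunP; case.
    have [->|/set0Pn [a aC]] := eqVneq C set0; [by left|right].
    by apply/setP=> b; rewrite (W b a) aC inE.
  have cT : #|[set: word 0]| = 1%N by rewrite cardsT card_ffun card_ord expn0.
  have pw1 s : pw (1 / 1) s = 1.
    by rewrite pw_pos /Rpower; [rewrite Rdiv_1_r ln_1 Rmult_0_r exp_0|lra].
  have S0 C : 0 <= mass rho 0 A C.
    apply: sumR_ge0 => a; apply: sumR_ge0 => b; rewrite /noise big_ord0; lra.
  have z s : pw (0 / 1) s = 0 by rewrite /Rdiv Rmult_0_l pw0.
  case: (c1 B) => EB; first by rewrite EB cards0 /= z !Rmult_0_r; apply: S0.
  case: (c1 A) => EA; first by have := S0 B; rewrite EA cards0 /= z Rmult_0_l Rmult_0_r.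
  have -> : mass rho 0 A B = 1.
    have U (F : word 0 -> R) c : (forall a, F a = c) -> \big[Rplus/0]_(a in setT) F a = c.
      move=> H; rewrite (eq_bigr (fun=> c)); last by move=> a _; exact: H.
      by rewrite big_const cT /= Rplus_0_r.
    by rewrite /mass EA EB; apply: (U) => a; apply: (U) => b; rewrite /noise big_ord0.
  by rewrite EA EB cT /= !pw1; lra.
rewrite mass_slice.
have p4 : 0 < 4 ^ n by apply: pow_lt; lra.
have p2 : 0 < 2 ^ n by apply: pow_lt; lra.
have d0 (C : {set word n}) : 0 <= INR #|C| / 2 ^ n.
  by apply: Rmult_le_pos; [exact: pos_INR|left; apply: Rinv_0_lt_compat].
have avg (C : {set word n.+1}) : INR #|C| / 2 ^ n.+1 =
    (INR #|slice n C true| / 2 ^ n + INR #|slice n C false| / 2 ^ n) / 2.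
  by rewrite card_slice /=; field; lra.
rewrite !avg.
have H := two_point rho r r' _ _ _ _ rho01 r1 r1' E (d0 (slice n A true))
  (d0 (slice n A false)) (d0 (slice n B true)) (d0 (slice n B false)).
have Htt := IH (slice n A true) (slice n B true).
have Hff := IH (slice n A false) (slice n B false).
have Htf := IH (slice n A true) (slice n B false).
have Hft := IH (slice n A false) (slice n B true).
have K1 := Rmult_le_compat_l (1 + rho) _ _ ltac:(lra) (Rplus_le_compat _ _ _ _ Htt Hff).
have K2 := Rmult_le_compat_l (1 - rho) _ _ ltac:(lra) (Rplus_le_compat _ _ _ _ Htf Hft).
apply: Rle_trans (Rplus_le_compat _ _ _ _ K1 K2).
have {}H := Rmult_le_compat_l (4 ^ n) _ _ (Rlt_le _ _ p4) H.
rewrite -tech_pow_Rmult (Rmult_comm 4) Rmult_assoc.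
by apply: Rle_trans H _; right; ring.
Qed.

Lemma UDCP_mass_le rho n (A B : {set word n}) : 0 <= rho <= 1 -> UDCP A B ->
  mass rho n A B <= (3 - rho) ^ n.
Proof.
move=> rho01 AB.
(* A pair of bits encodes an entry of [a - b]: whether it is zero, and whether it is 1.
   The code [(true, true)] does not occur and gets weight 0. *)
pose w (d : bool * bool) := if d.1 then if d.2 then 0 else 1 + rho else 1 - rho.
have w0 d : 0 <= w d by case: d => [[] []] /=; rewrite /w /=; lra.
pose D (p : word n * word n) : {ffun 'I_n -> bool * bool} :=
  [ffun i => (p.1 i == p.2 i, p.1 i && ~~ p.2 i)].
have noiseE p : noise rho n p.1 p.2 = \big[Rmult/1]_i w (D p i).
  by apply: eq_bigr => i _; rewrite ffunE /w /=; case: (p.1 i) (p.2 i) => [] [].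
have Dinj : {in setX A B &, injective D}.
  move=> [a1 b1] [a2 b2]; rewrite !inE /= => /andP[a1A b1B] /andP[a2A b2B] /ffunP E.
  (* Equal differences [a1 - b1 = a2 - b2] are equal sums [a1 + b2 = a2 + b1], so unique decoding
     applies with [b1] and [b2] exchanged. *)
  have [|-> ->] // := AB a1 a2 b2 b1 a1A a2A b2B b1B.
  move=> i; have := E i; rewrite !ffunE /wsum /=.
  by case: (a1 i) (a2 i) (b1 i) (b2 i) => [] [] [] [].
have -> : mass rho n A B = \big[Rplus/0]_(t in D @: setX A B) \big[Rmult/1]_i w (t i).
  rewrite big_imset //= /mass pair_big /=.
  by apply: eq_big => p; rewrite ?inE // noiseE.
(* Summing over all codes lets the sum factor by coordinate: the entries 0, 1, -1 contribute
   [(1 + rho) + 2 (1 - rho) = 3 - rho]. *)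
apply: Rle_trans (sumR_le_all _ _ _ _) _.
  move=> t; elim/big_ind: _ => [|x y|i _]; [lra|exact: Rmult_le_pos|exact: w0].
rewrite -(bigA_distr_bigA (fun _ : 'I_n => w)).
have -> : \big[Rplus/0]_j w j = 3 - rho.
  rewrite -(pair_bigA _ (fun x y => w (x, y))) /= !big_bool /w /=; ring.
by rewrite big_const card_ord; right; elim: (n) => //= k ->.
Qed.

(** * The trade-off and its optimization *)

Lemma ln_density_ge n c (C : {set word n}) :
  Rpower 2 (c * INR n) <= INR #|C| ->
  0 < INR #|C| / 2 ^ n /\
  - ((1 - c) * INR n * ln 2) <= ln (INR #|C| / 2 ^ n).
Proof.
move=> HC.
have C0 : 0 < INR #|C| by apply: Rlt_le_trans HC; apply: exp_pos.
have p2 : 0 < 2 ^ n by apply: pow_lt; lra.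
split; first by apply: Rdiv_lt_0_compat.
rewrite ln_div // ln_pow; last lra.
have : ln (Rpower 2 (c * INR n)) <= ln (INR #|C|) by apply: ln_le => //; apply: exp_pos.
rewrite ln_Rpower; lra.
Qed.

Lemma UDCP_tradeoff rho s n eps beta (A B : {set word n}) :
  0 < rho < 1 -> 0 < s -> (0 < n)%nat -> UDCP A B ->
  Rpower 2 ((1 - eps) * INR n) <= INR #|A| ->
  Rpower 2 (beta * INR n) <= INR #|B| ->
  (1 - rho ^ 2) * (ln 4 - ln (3 - rho)) <=
  ln 2 * (eps * (1 + rho * s) + (1 - beta) * (1 + rho / s)).
Proof.
move=> rho01 s0 n0 AB /ln_density_ge[A0 HA] /ln_density_ge[B0 HB].
have q0 : 0 < 1 - rho ^ 2 by nra.
have i0 : 0 < / (1 - rho ^ 2) by apply: Rinv_0_lt_compat.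
have qi : (1 - rho ^ 2) * / (1 - rho ^ 2) = 1 by apply: Rinv_r; lra.
have si : 0 < rho / s by apply: Rdiv_lt_0_compat; lra.
have sp : 0 < rho * s by apply: Rmult_lt_0_compat; lra.
pose r := (1 + rho * s) / (1 - rho ^ 2); pose r' := (1 + rho / s) / (1 - rho ^ 2).
have r1 : 1 <= r by rewrite /r /Rdiv; nra.
have r1' : 1 <= r' by rewrite /r' /Rdiv; nra.
(* The factors are [rho (s + rho) / (1 + rho s)] and [rho (1 + rho s) / (s + rho)], so [s]
   parametrizes admissible exponent pairs. *)
have E : (1 - / r) * (1 - / r') = rho ^ 2.
  by rewrite /r /r'; field; do !split; nra.
have rho01' : 0 <= rho <= 1 by lra.
have := Rle_trans _ _ _ (reverse_hypercontractive rho r r' n A B rho01' r1 r1' E)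
  (UDCP_mass_le rho n A B rho01' AB).
rewrite !pw_pos // => H.
have p4 : 0 < 4 ^ n by apply: pow_lt; lra.
have {H} : ln (4 ^ n * (Rpower (INR #|A| / 2 ^ n) r * Rpower (INR #|B| / 2 ^ n) r'))
    <= ln ((3 - rho) ^ n).
  apply: ln_le H; apply: Rmult_lt_0_compat => //.
  by apply: Rmult_lt_0_compat; apply: exp_pos.
rewrite ln_mult //; last by apply: Rmult_lt_0_compat; apply: exp_pos.
rewrite ln_mult; [|exact: exp_pos|exact: exp_pos].
rewrite !ln_Rpower !ln_pow; try lra.
have N0 : 0 < INR n by apply: (lt_INR 0); apply/ltP.
move=> H.
have {HA} := Rmult_le_compat_l r _ _ ltac:(lra) HA.
have {HB} := Rmult_le_compat_l r' _ _ ltac:(lra) HB.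
move=> HB HA.
have K : INR n * (ln 4 - ln (3 - rho)) <=
    INR n * (ln 2 * (r * eps + r' * (1 - beta))) by lra.
have {}K := Rmult_le_reg_l _ _ _ N0 K.
have {}K := Rmult_le_compat_l _ _ _ (Rlt_le _ _ q0) K.
apply: Rle_trans K _; right; rewrite /r /r'; field; lra.
Qed.

(** One stage of a numerical estimate: take a power, split off [2 ^ m], round down to a short
    decimal [d]. [L] carries the bound in terms of the original logarithms; a chain ending at
    [d = 1] bounds it from below. *)
Lemma ln_pow_ge (c d L : R) (k m : nat) : 0 < c -> 0 < d ->
  d * 2 ^ m <= c ^ k -> ln c <= L -> ln d <= INR k * L - INR m * ln 2.
Proof.
move=> c0 d0 cd cL.
have p2 : 0 < 2 ^ m by apply: pow_lt; lra.
have := ln_le _ _ (Rmult_lt_0_compat _ _ d0 p2) cd.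
rewrite ln_mult // !ln_pow //; last lra.
have := Rmult_le_compat_l _ _ _ (pos_INR k) cL; lra.
Qed.

(* 22639/36960 is a rational just below log_2 (4 / (3 - rho)) = log_2 (20000/13081) for
   rho = 0.3838. As 36960 = 16 * 14 * 15 * 11, the power is taken in four stages, each
   rescaled by a power of 2 and rounded down. *)
Lemma ln_ratio_ge : 22639 * ln 2 <= 36960 * ln (20000 / 13081).
Proof.
have H1 : ln 1.7416257577 <= 16 * ln (20000 / 13081) - 9 * ln 2.
  by have := ln_pow_ge (20000 / 13081) 1.7416257577 _ 16 9
    ltac:(lra) ltac:(lra) ltac:(lra) (Rle_refl _); rewrite /=; lra.
have H2 := ln_pow_ge 1.7416257577 1.1535536416 _ 14 11
    ltac:(lra) ltac:(lra) ltac:(lra) H1.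
have H3 := ln_pow_ge 1.1535536416 1.0653122744 _ 15 3
    ltac:(lra) ltac:(lra) ltac:(lra) H2.
have := ln_pow_ge 1.0653122744 1 _ 11 1
    ltac:(lra) ltac:(lra) ltac:(lra) H3.
by rewrite ln_1 /=; lra.
Qed.

Lemma rho_opt_bound :
  ln 2 * 0.5223 <= (1 - 0.3838 ^ 2) * (ln 4 - ln (3 - 0.3838)).
Proof.
have := ln_ratio_ge; have := ln_lt_2.
rewrite (_ : 20000 / 13081 = 4 / (3 - 0.3838)); last lra.
by rewrite ln_div; lra.
Qed.

(** For positive [x] and [y] the minimum over [s] is at [s = sqrt (y / x)]. If exactly one of them
    is 0, the infimum is approached as [s] tends to 0 or to infinity, hence the epsilon
    arguments. *)
Lemma optimize_tradeoff L rho x y : 0 <= rho -> 0 <= x -> 0 <= y ->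
  (forall s, 0 < s -> L <= x * (1 + rho * s) + y * (1 + rho / s)) ->
  L <= x + y + 2 * rho * sqrt (x * y).
Proof.
move=> rho0 [x0|<-] [y0|<-] H.
- pose u := sqrt x; pose v := sqrt y.
  have u0 : 0 < u by apply: sqrt_lt_R0.
  have v0 : 0 < v by apply: sqrt_lt_R0.
  have := H (v / u) (Rdiv_lt_0_compat _ _ v0 u0).
  rewrite sqrt_mult; try lra.
  have Eu : u * u = x by apply: sqrt_sqrt; lra.
  have Ev : v * v = y by apply: sqrt_sqrt; lra.
  rewrite -/u -/v -Eu -Ev.
  have -> : u * u * (1 + rho * (v / u)) + v * v * (1 + rho / (v / u)) =
    u * u + v * v + 2 * rho * (u * v) by field; lra.
  by [].
- rewrite Rmult_0_r sqrt_0; apply: le_epsilon => e e0.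
  (* The [+ 1] keeps the denominator positive when [rho = 0]. *)
  have d0 : 0 < x * rho + 1 by nra.
  have := H (e / (x * rho + 1)) (Rdiv_lt_0_compat _ _ e0 d0).
  have : x * rho * (e / (x * rho + 1)) <= e.
    have -> : x * rho * (e / (x * rho + 1)) = e - e / (x * rho + 1) by field; lra.
    have := Rdiv_lt_0_compat _ _ e0 d0; lra.
  lra.
- rewrite Rmult_0_l sqrt_0; apply: le_epsilon => e e0.
  have d0 : 0 < y * rho + 1 by nra.
  have := H ((y * rho + 1) / e) (Rdiv_lt_0_compat _ _ d0 e0).
  have -> : rho / ((y * rho + 1) / e) = rho * (e / (y * rho + 1)) by field; lra.
  have : y * rho * (e / (y * rho + 1)) <= e.
    have -> : y * rho * (e / (y * rho + 1)) = e - e / (y * rho + 1) by field; lra.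
    have := Rdiv_lt_0_compat _ _ e0 d0; lra.
  lra.
- by rewrite Rmult_0_l sqrt_0; have := H 1 Rlt_0_1; lra.
Qed.

Theorem theorem2 (n : nat) (eps beta : R) (A B : {set word n}) :
  (0 < n)%nat -> 0 <= eps -> UDCP A B ->
  Rpower 2 ((1 - eps) * INR n) <= INR #|A| ->
  Rpower 2 (beta * INR n) <= INR #|B| ->
  beta <= 0.4777 + eps + 0.7676 * sqrt (eps * (1 - beta)).
Proof.
move=> n0 eps0 AB HA HB.
have N0 : 0 < INR n by apply: (lt_INR 0); apply/ltP.
have l2 : 0 < ln 2 by have := ln_lt_2; lra.
(* [|B| <= 2 ^ n] forces [beta <= 1], so [optimize_tradeoff] applies with [y = 1 - beta]. *)
have beta1 : 0 <= 1 - beta.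
  have [D0] := ln_density_ge _ _ _ HB.
  have Hle : INR #|B| / 2 ^ n <= 1.
    have p2 : 0 < 2 ^ n by apply: pow_lt; lra.
    apply: (Rmult_le_reg_r (2 ^ n)) => //.
    have -> : INR #|B| / 2 ^ n * 2 ^ n = INR #|B| by field; lra.
    rewrite Rmult_1_l (_ : 2 = INR 2) // -pow_INR; apply: le_INR; apply/leP.
    have := max_card (mem B); rewrite card_ffun card_bool card_ord.
    by congr (_ <= _)%N; elim: (n) => //= k <-; rewrite expnS.
  have := ln_le _ _ D0 Hle; rewrite ln_1 => u v.
  have w : 0 <= (INR n * ln 2) * (1 - beta) by lra.
  case: (Rle_lt_dec 0 (1 - beta)) => // neg.
  have := Rmult_lt_0_compat _ _ N0 l2; nra.
(* The constants of the theorem are [0.4777 = 1 - 0.5223] and [0.7676 = 2 * 0.3838]. *)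
have : 0.5223 <= eps + (1 - beta) + 2 * 0.3838 * sqrt (eps * (1 - beta)).
  apply: optimize_tradeoff => //; first lra.
  move=> s s0; apply: (Rmult_le_reg_l (ln 2)) => //.
  apply: Rle_trans rho_opt_bound _.
  by apply: (UDCP_tradeoff _ _ n _ _ A B) => //; lra.
lra.
Qed.
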